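(* Let $G>I$ be a finite group with $Z(G)=I$ and $\sigma_1,\sigma_2\in G$ with $G=\langle\sigma_1,\sigma_2\rangle$, $\sigma_1\sigma_2\sigma_1=\sigma_2\sigma_1\sigma_2$, $o(\sigma_1\sigma_2\sigma_1)=2$, $C=[\sigma_1]$, and let $[\underline{\sigma}]=[\sigma_1,\sigma_2,\sigma_1,\sigma_1,\sigma_2,\sigma_1]$ (a generating $6$-system). Then $$Z_{40}=[\underline{\sigma}]^{B_6}=[\underline{\sigma}]^{H_6}\subseteq\Sigma^i(C,C,C,C,C,C)$$ is an orbit of length $40$ under the action of $B_6$ and also under the action of $H_6$, such that $\rho_6(\beta_{ij})$ has cycle type $(1)^{13}(3)^9$ for all $1\le i<j\le 6$, $\rho_6(B_6)\cong S_4(3)$, $\rho_6(\beta_j)$ has cycle type $(1)^{13}(3)^9$ for $2\le j\le 6$, $\rho_6(H_6)\cong S_4(3)$, and the genus is $g_{Z_{40}}=6$.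
   Context: $\iota$ is the identity and $I$ the trivial group. For conjugacy classes $C_1,\dots,C_m$, $\Sigma^i(C_1,\dots,C_m)$ is the set of $G$-conjugacy classes $[\sigma_1,\dots,\sigma_m]$ (simultaneous conjugation) of tuples with $\sigma_j\in C_j$, $\langle\sigma_1,\dots,\sigma_m\rangle=G$, $\sigma_1\cdots\sigma_m=\iota$. The Hurwitz braid group $H_m$ is generated by $\beta_2,\dots,\beta_m$ with relations $\beta_i\beta_j=\beta_j\beta_i$ ($|i-j|>1$), $\beta_i\beta_{i+1}\beta_i=\beta_{i+1}\beta_i\beta_{i+1}$, $\beta_2\cdots\beta_{m-1}\beta_m^2\beta_{m-1}\cdots\beta_2=1$, and acts from the right by $[\underline{\sigma}]^{\beta_i}=[\sigma_1,\dots,\sigma_{i-2},\sigma_{i-1}\sigma_i\sigma_{i-1}^{-1},\sigma_{i-1},\sigma_{i+1},\dots,\sigma_m]$. The pure braid group $B_m$ is generated by $\beta_{ij}=\beta_{i+1}^{-1}\cdots\beta_{j-1}^{-1}\beta_j^2\beta_{j-1}\cdots\beta_{i+1}$, $1\le i<j\le m$. $\rho_m$ denotes the induced permutation representation on the orbit. For a $B_m$-orbit $Z$, $g_Z=1-|Z|+\frac12\big((m-1)|Z|-\sum_{j=2}^m z_{1j}\big)$ with $z_{1j}$ the number of cycles (fixed points included) of $\rho_m(\beta_{1j})$ on $Z$. $S_4(3)=PSp_4(3)$ is the projective symplectic group of dimension $4$ over $\mathbb{F}_3$; cycle type $(1)^{13}(3)^9$ means $13$ fixed points and $9$ three-cycles.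 *)

(* Defs.v *)
From HB Require Import structures.
From mathcomp Require Import all_boot all_order all_fingroup all_algebra.
From mathcomp Require Import all_solvable zify.
Set Implicit Arguments. Unset Strict Implicit. Unset Printing Implicit Defensive.
Import GRing.Theory.

Local Open Scope group_scope.

Section Hurwitz.
Variables (gT : finGroupType) (m : nat).
Notation T := (m.-tuple gT).

Definition ent (t : T) (k : nat) : gT := nth 1 t k.

(* Hurwitz braid generator beta_j (2 <= j <= m), acting from the right:
   (.., s_{j-1}, s_j, ..) |-> (.., s_{j-1} s_j s_{j-1}^-1, s_{j-1}, ..).
   Recall that in MathComp  x ^ y = y^-1 * x * y.
   Entry j-1 (1-based) is 0-based index j.-2, entry j is index j.-1.
   For j outside [2, m] the map is the identity (never used). *)
Definition hur (j : nat) (t : T) : T :=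
  if (1 < j <= m)%N then
    [tuple (if val i == j.-2 then ent t j.-1 ^ (ent t j.-2)^-1
            else if val i == j.-1 then ent t j.-2 else tnth t i) | i < m]
  else t.

Definition hurinv (j : nat) (t : T) : T :=
  if (1 < j <= m)%N then
    [tuple (if val i == j.-2 then ent t j.-1
            else if val i == j.-1 then ent t j.-2 ^ ent t j.-1 else tnth t i) | i < m]
  else t.

Lemma nth_mktuple1 (f : 'I_m -> gT) k (hk : (k < m)%N) :
  nth 1 [tuple f i | i < m] k = f (Ordinal hk).
Proof. by rewrite -(tnth_nth 1 _ (Ordinal hk)) tnth_mktuple. Qed.

Lemma hurK j : cancel (hur j) (hurinv j).
Proof.
move=> t; rewrite /hurinv /hur.
have [/andP [j1 jm]|] := boolP (1 < j <= m)%N; last by [].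
have ha : (j.-2 < m)%N by lia.
have hb : (j.-1 < m)%N by lia.
have hab : (j.-1 == j.-2) = false by apply/eqP; lia.
apply: eq_from_tnth => i; rewrite !tnth_mktuple /ent !nth_mktuple1 /=.
rewrite hab eqxx.
case: eqP => [ia|_].
  by rewrite (tnth_nth 1) ia.
case: eqP => [ib|_]; last by [].
by rewrite eqxx conjgKV (tnth_nth 1) ib.
Qed.

Definition beta (j : nat) : {perm T} := perm (can_inj (@hurK j)).

(* beta_{ij} = beta_{i+1}^-1 ... beta_{j-1}^-1 beta_j^2 beta_{j-1} ... beta_{i+1};
   the product of permutations  p * q  means "first p, then q" (right action) *)
Definition beta2 (i j : nat) : {perm T} :=
  (\prod_(i.+1 <= k < j) (beta k)^-1) * (beta j * beta j)
  * (\prod_(i.+1 <= k < j) beta (i + j - k)).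

Definition tconj (t : T) (g : gT) : T := [tuple tnth t i ^ g | i < m].
Definition tclass (G : {set gT}) (t : T) : {set T} := [set tconj t g | g in G].

Definition Pset (p : {perm T}) : {perm {set T}} := perm (imset_inj (@perm_inj _ p)).

Definition Sigma_i (G : {set gT}) (Cs : m.-tuple {set gT}) : {set {set T}} :=
  [set tclass G t | t in [set t : T | [forall i, tnth t i \in tnth Cs i]
       && (<<[set tnth t i | i : 'I_m]>> == G)
       && (\prod_(i < m) tnth t i == 1)]].

Definition H_gens : {set {perm {set T}}} :=
  [set Pset (beta j) | j : 'I_m.+1 & (2 <= j)%N].
Definition B_gens : {set {perm {set T}}} :=
  [set Pset (beta2 (val ij.1) (val ij.2)) | ij : 'I_m.+1 * 'I_m.+1
       & (1 <= ij.1)%N && (ij.1 < ij.2)%N].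

End Hurwitz.

Definition ncycles_len (U : finType) (Z : {set U}) (p : {perm U}) (k : nat) : nat :=
  #|[set porbit p x | x in Z & #|porbit p x| == k]|.

Definition ncycles (U : finType) (Z : {set U}) (p : {perm U}) : nat :=
  #|[set porbit p x | x in Z]|.

Definition cycle_type_1_3 (U : finType) (Z : {set U}) (p : {perm U}) (a b : nat) :=
  forall k, ncycles_len Z p k = (if k == 1 then a else if k == 3 then b else 0)%N.

Definition sum_z (m : nat) (z : nat -> nat) : nat := \sum_(2 <= j < m.+1) z j.

Definition genus (m zsize : nat) (z : nat -> nat) : rat :=
  (1 - zsize%:R + ((m.-1 * zsize)%N%:R - (sum_z m z)%:R) / 2%:R)%R.

Definition Jsymp : 'M['F_3]_4 :=
  \matrix_(i < 4, j < 4)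
    (if val j == (val i + 2)%N then 1%R else if val i == (val j + 2)%N then (-1)%R else 0%R).

Definition Sp43 : {set {'GL_4['F_3]}} :=
  [set g : {'GL_4['F_3]} | ((GLval g)^T *m Jsymp *m GLval g == Jsymp)%R].

Definition PSp43 := (Sp43 / 'Z(Sp43))%g.

(* Main.v *)
(* The relations make G a quotient of the modular group Z/2 * Z/3, with s1 s2 s1
   and s1 s2 as generators. In the modular group itself the 6-systems of braid
   generators with product 1 form 40 classes under conjugation, and reducing
   them to S_3, whose involutions are the points of the affine line over F_3,
   labels the classes by the 40 lines of a symplectic space F_3^4 in such a way
   that beta_j acts as a symplectic transvection. Since transvections are
   transitive on hyperbolic pairs, an identification of two distinct classes in G
   would force beta_2 to fix the class of (s1, s2, s1, s1, s2, s1), hence s1 = s2,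
   and G would be abelian. So the orbit is the set of all 40 lines, the five
   transvections generate Sp_4(3), and the kernel of its action on lines is its
   centre. *)
Require Import Defs.
From HB Require Import structures.
From mathcomp Require Import all_boot all_order all_fingroup all_algebra all_solvable.
From mathcomp Require Import ring zify.
Set Implicit Arguments. Unset Strict Implicit. Unset Printing Implicit Defensive.
Import GRing.Theory.

Local Open Scope group_scope.


(** * Words in the modular group *)

(* [None] is an involution a, [Some true] an element b of order 3 and
   [Some false] its inverse: words in the free product Z/2 * Z/3. *)
Definition letter := option bool.
Definition word := seq letter.

(** Left multiplication on reduced words, in which [None] and [Some _] alternate; the case [s == t]
    encodes [b * b = b^-1]. *)
Definition push (l : letter) (w : word) : word :=
  match l, w with
  | None, None :: w' => w'
  | Some s, Some t :: w' => if s == t then Some (~~ s) :: w' else w'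
  | _, _ => l :: w
  end.

Definition normal_form : word -> word := foldr push [::].

Definition word_inv (w : word) : word := rev (map (omap negb) w).

Definition word_hur (j : nat) (t : seq word) : seq word :=
  let x := nth [::] t j.-2 in
  [seq if i == j.-2 then x ++ nth [::] t j.-1 ++ word_inv x
       else if i == j.-1 then x else nth [::] t i | i <- iota 0 6].

Section Evaluation.
Variables (gT : finGroupType) (a b : gT).
Hypotheses (a2 : a ^+ 2 = 1) (b3 : b ^+ 3 = 1).

Definition eval_letter (l : letter) : gT :=
  if l is Some s then (if s then b else b^-1) else a.

Definition eval (w : word) : gT := \prod_(l <- w) eval_letter l.

Lemma eval_cons l w : eval (l :: w) = eval_letter l * eval w.
Proof. by rewrite /eval big_cons. Qed.

Lemma eval_cat v w : eval (v ++ w) = eval v * eval w.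
Proof. by rewrite /eval big_cat. Qed.

Lemma eval_inv w : eval (word_inv w) = (eval w)^-1.
Proof.
elim: w => [|l w IH]; first by rewrite /eval !big_nil invg1.
rewrite /word_inv /= rev_cons -cats1 eval_cat IH !eval_cons /eval big_nil.
rewrite mulg1 invMg; congr (_ * _); case: l => [[]|] //=; first by rewrite invgK.
by apply/eqP; rewrite eq_sym eq_invg_mul -expg2 a2.
Qed.

Lemma eval_push l w : eval (push l w) = eval_letter l * eval w.
Proof.
have bb : b * b = b^-1.
  by apply/eqP; rewrite eq_sym eq_invg_mul -expg2 -expgS b3.
have BB : b^-1 * b^-1 = b by rewrite -invMg bb invgK.
case: l w => [s|] [|[t|] w] //=; rewrite ?eval_cons //=.
  by case: s t => [] [] /=; rewrite ?eval_cons /= mulgA ?bb ?BB ?mulgV ?mulVg ?mul1g.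
by rewrite mulgA -expg2 a2 mul1g.
Qed.

Lemma eval_normal_form w : eval (normal_form w) = eval w.
Proof. by elim: w => //= l w IH; rewrite eval_push IH eval_cons. Qed.

(** This makes a single computation with words valid in every group with such [a] and [b]. *)
Lemma eval_eq v w : normal_form v == normal_form w -> eval v = eval w.
Proof. by move/eqP => e; rewrite -eval_normal_form e eval_normal_form. Qed.

Definition eval_tuple (t : seq word) : 6.-tuple gT :=
  [tuple eval (nth [::] t i) | i < 6].

Lemma eval_word_hur j t :
  (1 < j <= 6)%N -> eval_tuple (word_hur j t) = hur j (eval_tuple t).
Proof.
move=> hj; apply: eq_from_tnth => i; rewrite /hur hj !tnth_mktuple /ent.
have h1 : (j.-1 < 6)%N by lia.
have h2 : (j.-2 < 6)%N by lia.
rewrite !nth_mktuple1 /= (nth_map 0%N) ?size_iota // nth_iota // add0n.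
case: (_ == j.-2); first by rewrite !eval_cat eval_inv /conjg invgK.
by case: (_ == j.-1).
Qed.

End Evaluation.

(** * Labelling by vectors over F_3 *)

Definition quad : Type := ('F_3 * 'F_3 * 'F_3 * 'F_3)%type.

(** With [a = s1 s2 s1] and [b = s1 s2] these are [s1], [s2], the conjugate of [s1] by [b], and the
    conjugate of the latter by [a]. *)
Definition palette : seq word :=
  let a := None in let b := Some true in
  [:: [:: Some false; a]; [:: a; Some false]; [:: b; a; b]; [:: a; b; a; b; a]].

(* Image of the palette under the quotient map to S_3, whose three involutions
   are identified with F_3 so that conjugation becomes (x, y) |-> 2x - y. *)
Definition colour (k : nat) : 'F_3 := nth 0%R [:: 0; 1; -1; -1]%R k.

(* The colourings with trivial alternating sum, modulo constants, form the
   symplectic space; these are its coordinates on a hyperbolic basis. *)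
Definition quad_of (t : seq nat) : quad :=
  let x k := colour (nth 0%N t k) in
  (x 1%N - x 2%N, x 4%N - x 5%N, x 1%N - x 0%N, x 4%N - x 3%N)%R.

Definition quad_opp (q : quad) : quad :=
  let: (x, y, z, w) := q in (- x, - y, - z, - w)%R.

Definition spell (t : seq nat) : seq word := map (nth [::] palette) t.

Fixpoint all_seqs (n : nat) : seq (seq nat) :=
  if n is n'.+1 then [seq k :: t | k <- iota 0 4, t <- all_seqs n'] else [:: [::]].

(* The 6-systems over the palette meet every class of 6-systems of the modular
   group; several of them may represent the same class. *)
Definition systems : seq (quad * seq nat) :=
  [seq (quad_of t, t) | t <- all_seqs 6 & normal_form (flatten (spell t)) == [::]].

(** Accepting both signs makes the chosen system depend only on the line of [q]. The list is an
    argument so that a computation can share it. *)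
Definition lookup (s : seq (quad * seq nat)) (q : quad) : seq word :=
  let q' := quad_opp q in
  spell (nth (q, [::]) s (find (fun p => (p.1 == q) || (p.1 == q')) s)).2.

Definition system_of : quad -> seq word := lookup systems.

Definition qform (p q : quad) : 'F_3 :=
  let: (x0, x1, x2, x3) := p in let: (y0, y1, y2, y3) := q in
  (x0 * y2 + x1 * y3 - x2 * y0 - x3 * y1)%R.

(* The chain of roots of the braid generators; since the F_3-space of colourings
   has dimension 4, the third root depends on the first and the fifth. *)
Definition qroot (j : nat) : quad :=
  nth (0, 0, 0, 0)%R
    [:: (1, 0, 0, 0); (0, 0, 1, 0); (-1, 0, 0, -1); (0, 1, 0, 0); (0, 0, 0, 1)]%R
    j.-2.

Definition qtransvection (j : nat) (p : quad) : quad :=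
  let c := qform p (qroot j) in
  let: (x0, x1, x2, x3) := p in let: (y0, y1, y2, y3) := qroot j in
  (x0 + c * y0, x1 + c * y1, x2 + c * y2, x3 + c * y3)%R.

Definition quads : seq quad :=
  let s := [:: 0; 1; -1]%R in
  [seq (p, w) | p <- [seq (p, z) | p <- [seq (x, y) | x <- s, y <- s], z <- s], w <- s].

(** Short elements of the modular group, sufficient for the conjugacy checks [system_equivariant]
    and [system_base]. *)
Definition conjugators : seq word :=
  let a := None in let b := Some true in let B := Some false in
  [:: [::]; [:: a]; [:: b]; [:: B]; [:: a; b]; [:: b; a]; [:: B; a]; [:: a; B];
      [:: a; b; a; b]; [:: b; a; b; a]].

Definition conj_systems (t u : seq word) : bool :=
  has (fun c => all (fun i =>
    normal_form (word_inv c ++ nth [::] t i ++ c) == normal_form (nth [::] u i))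
    (iota 0 6)) conjugators.

Definition quad0 : quad := (0, 0, 0, 0)%R.

(** The link between braids and symplectic geometry, checked by computation for all 80 nonzero
    labels and the five generators. *)
Lemma system_equivariant : all (fun q => (q == quad0) || all (fun j =>
    conj_systems (word_hur j (system_of q)) (system_of (qtransvection j q)))
    (iota 2 5)) quads.
Proof.
(* The [let] makes the virtual machine enumerate [systems] only once. *)
have: let s := systems in all (fun q => (q == quad0) || all (fun j =>
    conj_systems (word_hur j (lookup s q)) (lookup s (qtransvection j q)))
    (iota 2 5)) quads by vm_cast_no_check (erefl true).
exact.
Qed.

(** The indices spell [s1, s2, s1, s1, s2, s1]; the colours 0, 1, 0, 0, 1, 0 have all four
    coordinates of [quad_of] equal to 1. *)
Lemma system_base : conj_systems (spell [:: 0; 1; 0; 0; 1; 0]%N) (system_of (1,1,1,1)%R).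
Proof. by vm_compute. Qed.

Definition grow (s : seq quad) : seq quad :=
  undup (s ++ [seq qtransvection j q | q <- s, j <- iota 2 5]).

(** Breadth-first search for transitivity on nonzero vectors; eight rounds suffice. *)
Lemma quads_reached :
  all (fun q => (q == quad0) || (q \in iter 8 grow [:: (1, 0, 0, 0)%R])) quads.
Proof.
have: let s := iter 8 grow [:: (1, 0, 0, 0)%R] in
  all (fun q => (q == quad0) || (q \in s)) quads by vm_cast_no_check (erefl true).
exact.
Qed.

(** * Transvections of the symplectic space over F_3 *)

Local Notation rV := 'rV['F_3]_4.

Lemma F3P (c : 'F_3) : [\/ c = 0%R, c = 1%R | c = (-1)%R].
Proof.
case: c => [[|[|[|//]]] ?]; [apply: Or31|apply: Or32|apply: Or33];
  exact: val_inj.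
Qed.

Lemma F3_sqr (c : 'F_3) : c != 0%R -> (c * c = 1)%R.
Proof. by case: (F3P c) => ->; rewrite ?mulrNN ?mulr1 ?eqxx. Qed.

Local Notation I4 k := (@Ordinal 4 k isT).

Lemma forall_I4 (P : 'I_4 -> Prop) :
  P (I4 0) -> P (I4 1) -> P (I4 2) -> P (I4 3) -> forall i, P i.
Proof.
by move=> h0 h1 h2 h3 [[|[|[|[|//]]]] hi];
  [move: h0|move: h1|move: h2|move: h3]; congr (P _); apply: val_inj.
Qed.

Lemma sum_I4 (V : nmodType) (F : 'I_4 -> V) :
  (\sum_i F i = F (I4 0) + F (I4 1) + F (I4 2) + F (I4 3))%R.
Proof.
rewrite !big_ord_recl big_ord0 addr0 !addrA.
by congr (_ + _ + _ + _)%R; congr (F _); apply: val_inj.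
Qed.

Definition quad_of_row (v : rV) : quad :=
  (v ord0 (I4 0), v ord0 (I4 1), v ord0 (I4 2), v ord0 (I4 3)).

Definition row_of_quad (q : quad) : rV :=
  \row_i nth 0%R [:: q.1.1.1; q.1.1.2; q.1.2; q.2] i.

Lemma quad_of_rowK : cancel quad_of_row row_of_quad.
Proof.
by move=> v; apply/rowP; apply: forall_I4; rewrite mxE.
Qed.

Lemma row_of_quadK : cancel row_of_quad quad_of_row.
Proof. by case=> [[[x y] z] w]; rewrite /quad_of_row !mxE. Qed.

Lemma quad_of_row_in v : quad_of_row v \in quads.
Proof.
have h (c : 'F_3) : c \in [:: 0; 1; -1]%R.
  by case: (F3P c) => ->; rewrite !inE eqxx ?orbT.
by do 3 !apply: allpairs_f => //.
Qed.

Lemma quad_of_row0 v : (quad_of_row v == quad0) = (v == 0%R).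
Proof.
rewrite -(can_eq quad_of_rowK); congr (_ == _).
by rewrite /quad_of_row !mxE.
Qed.

Lemma quad_of_rowN v : quad_of_row (- v)%R = quad_opp (quad_of_row v).
Proof. by rewrite /quad_of_row /quad_opp !mxE. Qed.

Lemma quad_oppK : involutive quad_opp.
Proof. by case=> [[[x y] z] w]; rewrite /quad_opp !opprK. Qed.

Definition sform (x y : rV) : 'F_3 := (x *m Jsymp *m y^T)%R ord0 ord0.

Lemma sformE x y : sform x y = qform (quad_of_row x) (quad_of_row y).
Proof.
rewrite /sform /qform /quad_of_row !mxE sum_I4 !mxE !sum_I4 !mxE /=.
by ring.
Qed.

Lemma sformDl x y z : sform (x + y)%R z = (sform x z + sform y z)%R.
Proof. by rewrite /sform !mulmxDl mxE. Qed.
Lemma sformDr x y z : sform z (x + y)%R = (sform z x + sform z y)%R.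
Proof. by rewrite /sform linearD mulmxDr mxE. Qed.
Lemma sformZl c x z : sform (c *: x)%R z = (c * sform x z)%R.
Proof. by rewrite /sform -!scalemxAl mxE. Qed.
Lemma sformZr c x z : sform z (c *: x)%R = (c * sform z x)%R.
Proof. by rewrite /sform linearZ /= -scalemxAr mxE. Qed.
Lemma sformC x y : sform y x = (- sform x y)%R.
Proof. by rewrite !sformE /qform /quad_of_row; ring. Qed.
Lemma sformxx x : sform x x = 0%R.
Proof. by rewrite !sformE /qform /quad_of_row; ring. Qed.
Lemma sformNl x z : sform (- x)%R z = (- sform x z)%R.
Proof. by rewrite -scaleN1r sformZl mulN1r. Qed.
Lemma sformNr x z : sform z (- x)%R = (- sform z x)%R.
Proof. by rewrite -scaleN1r sformZr mulN1r. Qed.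
Lemma sform0l z : sform 0%R z = 0%R.
Proof. by rewrite -(scale0r 0%R) sformZl mul0r. Qed.
Lemma sform0r z : sform z 0%R = 0%R.
Proof. by rewrite sformC sform0l oppr0. Qed.

Definition std_row (k : nat) : rV := row_of_quad (nth quad0
  [:: (1,0,0,0); (0,1,0,0); (0,0,1,0); (0,0,0,1)]%R k).

Lemma sform_nondeg x : x != 0%R -> exists y, sform y x = 1%R.
Proof.
move=> x0; have [y hy] : exists y, sform y x != 0%R.
  apply/existsP; apply: contraNT x0 => /existsPn h.
  rewrite -quad_of_row0 /quad_of_row /quad0.
  (* Each coordinate of [x] is, up to sign, its pairing with one standard row. *)
  have e k := eqP (negbNE (h (std_row k))).
  have -> : x ord0 (I4 0) = (- sform (std_row 2) x)%R
    by rewrite sformE row_of_quadK /qform /=; ring.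
  have -> : x ord0 (I4 1) = (- sform (std_row 3) x)%R
    by rewrite sformE row_of_quadK /qform /=; ring.
  have -> : x ord0 (I4 2) = (sform (std_row 0) x)%R
    by rewrite sformE row_of_quadK /qform /=; ring.
  have -> : x ord0 (I4 3) = (sform (std_row 1) x)%R
    by rewrite sformE row_of_quadK /qform /=; ring.
  by rewrite !e oppr0.
by exists (sform y x *: y)%R; rewrite sformZl F3_sqr.
Qed.

Definition GL43 : finGroupType := {'GL_4['F_3]}.

(* Locked, as unification would otherwise unfold products in GL_4(3) to matrix
   products. *)
HB.lock Definition GLmx (g : GL43) : 'M['F_3]_4 := GLval g.

Lemma GLmxM (g h : GL43) : GLmx (g * h)%g = (GLmx g *m GLmx h)%R.
Proof. by rewrite !GLmx.unlock. Qed.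

Lemma GLmx1 : GLmx 1 = 1%:M%R.
Proof. by rewrite GLmx.unlock. Qed.

Lemma Jsymp_sqr : (Jsymp *m Jsymp = - 1%:M)%R.
Proof.
apply/matrixP; apply: forall_I4; apply: forall_I4; rewrite !mxE sum_I4 !mxE /=;
  exact: val_inj.
Qed.

Lemma bilinear_mx_inj (A B : 'M['F_3]_4) :
  (forall x y : rV, (x *m A *m y^T) ord0 ord0 = (x *m B *m y^T) ord0 ord0)%R ->
  A = B.
Proof.
move=> h; apply/matrixP => i j; have := h (delta_mx ord0 i) (delta_mx ord0 j).
by rewrite trmx_delta -!rowE -!colE !mxE.
Qed.

Lemma Sp43P (g : GL43) :
  reflect (forall x y, sform (x *m GLmx g)%R (y *m GLmx g)%R = sform x y)
    (g \in (Sp43 : {set GL43})).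
Proof.
rewrite inE GLmx.unlock; set A := GLval g.
(* [Sp43] is defined through columns, while the action here is on rows. Since [Jsymp] squares to -1,
   the first condition makes [- (Jsymp *m B^T *m Jsymp)] a left inverse of [B]; it is then a right
   inverse, which is the second condition. *)
have -> : (A^T *m Jsymp *m A == Jsymp)%R = (A *m Jsymp *m A^T == Jsymp)%R.
  have key (B : 'M['F_3]_4) : (B^T *m Jsymp *m B == Jsymp -> B *m Jsymp *m B^T == Jsymp)%R.
    move/eqP => h.
    have /mulmx1C : ((- (Jsymp *m B^T *m Jsymp)) *m B = 1%:M)%R.
      by rewrite mulNmx -!mulmxA (mulmxA B^T)%R h Jsymp_sqr opprK.
    move/(congr1 (fun M => M *m Jsymp)%R); rewrite mul1mx mulmxN mulNmx -!mulmxA Jsymp_sqr.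
    by rewrite !mulmxN !mulmx1 opprK !mulmxA => ->.
  by apply/idP/idP => [/key|] //; rewrite -{1}[A]trmxK => /key; rewrite trmxK.
apply: (iffP eqP) => [h x y|h].
  by rewrite /sform trmx_mul !mulmxA -(mulmxA x) -(mulmxA x) h.
by apply: bilinear_mx_inj => x y; rewrite -[RHS]h /sform trmx_mul !mulmxA.
Qed.

Lemma Sp43_group_set : group_set (Sp43 : {set GL43}).
Proof.
apply/group_setP; split; first by apply/Sp43P => x y; rewrite GLmx1 !mulmx1.
move=> g h /Sp43P hg /Sp43P hh; apply/Sp43P => x y.
by rewrite GLmxM !mulmxA hh hg.
Qed.
Definition Sp : {group GL43} := Group Sp43_group_set.

Definition transvection_mx (c : 'F_3) (w : rV) : 'M['F_3]_4 :=
  (1%:M + c *: (Jsymp *m w^T *m w))%R.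

Lemma mul_transvection_mx c w x :
  (x *m transvection_mx c w = x + (c * sform x w) *: w)%R.
Proof.
rewrite /transvection_mx mulmxDr mulmx1 -scalemxAr !mulmxA -scalerA; congr (_ + _ *: _)%R.
by rewrite [X in (X *m w)%R]mx11_scalar mul_scalar_mx.
Qed.

Lemma transvection_mxK c d w :
  (transvection_mx c w *m transvection_mx d w = transvection_mx (c + d) w)%R.
Proof.
apply/row_matrixP => i; rewrite !rowE mulmxA !mul_transvection_mx.
rewrite sformDl sformZl sformxx mulr0 addr0 -addrA -scalerDl; congr (_ + _ *: _)%R.
by ring.
Qed.

Lemma transvection_mx0 w : transvection_mx 0%R w = 1%:M%R.
Proof. by rewrite /transvection_mx scale0r addr0. Qed.

Lemma transvection_unit c w : transvection_mx c w \is a GRing.unit.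
Proof.
have h : (transvection_mx c w *m transvection_mx (- c) w = 1%:M)%R.
  by rewrite transvection_mxK subrr transvection_mx0.
by have [hu _] := mulmx1_unit h; exact: hu.
Qed.

Definition transvection c w : GL43 :=
  FinRing.unit 'M['F_3]_4 (transvection_unit c w).

Lemma mul_transvection c w x :
  (x *m GLmx (transvection c w) = x + (c * sform x w) *: w)%R.
Proof. by rewrite GLmx.unlock; exact: mul_transvection_mx. Qed.

Lemma GL_eqP (g h : GL43) :
  (forall x : rV, x *m GLmx g = x *m GLmx h)%R -> g = h.
Proof.
move=> e; apply: val_inj; apply/row_matrixP => i; rewrite !rowE.
by have := e (delta_mx ord0 i); rewrite GLmx.unlock.
Qed.

Lemma transvectionM c d w :
  transvection c w * transvection d w = transvection (c + d)%R w.
Proof. by apply: val_inj; apply: transvection_mxK. Qed.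

Lemma transvection0 w : transvection 0%R w = 1.
Proof. by apply: val_inj; apply: transvection_mx0. Qed.

Lemma transvectionV c w : (transvection c w)^-1 = transvection (- c)%R w.
Proof.
apply: (mulgI (transvection c w)).
by rewrite mulgV transvectionM subrr transvection0.
Qed.

Lemma transvectionN c w : transvection c (- w)%R = transvection c w.
Proof.
apply: GL_eqP => x; rewrite !mul_transvection sformNr mulrN.
by rewrite scalerN scaleNr opprK.
Qed.

Lemma transvection_Sp c w : transvection c w \in Sp.
Proof.
apply/Sp43P => x y; rewrite !mul_transvection.
rewrite !(sformDl, sformDr, sformZl, sformZr) sformxx (sformC y w); ring.
Qed.

(** An isometry preserves the coefficient [sform x w], so conjugation only moves the root. *)
Lemma transvectionJ c w (g : GL43) :
  g \in Sp -> transvection c w ^ g = transvection c (w *m GLmx g)%R.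
Proof.
move/Sp43P=> hg; apply: (mulgI g); rewrite -conjgC.
apply: GL_eqP => x; rewrite !GLmxM !mulmxA !mul_transvection hg.
by rewrite mulmxDl scalemxAl.
Qed.

Definition braid_root (j : nat) : rV := row_of_quad (qroot j).
Definition tau (j : nat) : GL43 := transvection 1%R (braid_root j).

Lemma quad_of_tau v j :
  quad_of_row (v *m GLmx (tau j))%R = qtransvection j (quad_of_row v).
Proof.
rewrite /tau mul_transvection mul1r sformE /braid_root row_of_quadK /qtransvection.
set c := qform _ _; move: c => c; rewrite /quad_of_row.
by case: (qroot j) => [[[a b] d] e] /=; rewrite !mxE.
Qed.

(** * Generation of Sp_4(3) *)

Definition braid_transvections : {set GL43} :=
  [set tau j | j : 'I_7 & (2 <= j)%N].
Definition braid_group : {group GL43} := <<braid_transvections>>%G.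

Local Notation T := braid_group.

Lemma tau_in j : (2 <= j <= 6)%N -> tau j \in T.
Proof.
case/andP=> j2 j6; apply/mem_gen/imsetP.
by exists (Ordinal (j6 : (j < 7)%N)); rewrite ?inE.
Qed.

Lemma braid_group_sub_Sp : T \subset Sp.
Proof.
rewrite gen_subG; apply/subsetP => _ /imsetP[j _ ->].
exact: transvection_Sp.
Qed.

Lemma braid_group_trans v :
  v != 0%R -> exists2 h, h \in T & v = (std_row 0 *m GLmx h)%R.
Proof.
move=> v0; suff h n q : q \in iter n grow [:: (1, 0, 0, 0)%R] ->
    exists2 h, h \in T & row_of_quad q = (std_row 0 *m GLmx h)%R.
  (* The list of reached vectors is made abstract, so that it is never unfolded. *)
  move: (h 8) quads_reached; move: (iter 8 _ _) => s hs.
  move/allP/(_ _ (quad_of_row_in v)).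
  by rewrite quad_of_row0 (negPf v0) => /hs; rewrite quad_of_rowK.
elim: n q => [|n IH] q /=.
  by rewrite inE => /eqP->; exists (1 : GL43); rewrite ?group1 // GLmx1 mulmx1.
rewrite mem_undup mem_cat => /orP[/IH //|/allpairsP[[p j] /= [/IH[h hT e]]]].
rewrite !inE => hj ->; exists (h * tau j); first by rewrite groupM ?tau_in //; lia.
by rewrite GLmxM mulmxA -e -[RHS]quad_of_rowK quad_of_tau row_of_quadK.
Qed.

(** The root of [tau 2] is [std_row 0], so by transitivity its conjugates under [T] are all
    transvections of coefficient 1; their inverses have coefficient -1. *)
Lemma transvection_in_braid_group c w : transvection c w \in T.
Proof.
have [->|w0] := eqVneq w 0%R.
  suff -> : transvection c 0%R = 1 by exact: group1.
  by apply: GL_eqP => x; rewrite mul_transvection scaler0 addr0 GLmx1 mulmx1.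
suff h1 : transvection 1%R w \in T.
  case: (F3P c) => -> //; first by rewrite transvection0 group1.
  rewrite -transvectionV.
  exact: (@groupVr _ T _ h1).
have [h hT ->] := braid_group_trans w0.
rewrite -transvectionJ; last exact: (subsetP braid_group_sub_Sp).
exact: (@groupJ _ T _ _ (@tau_in 2 isT) hT).
Qed.

(** The transvection along [y - x] with coefficient [sform x y] adds [(sform x y)^2 = 1] times
    [y - x] to [x], and fixes every vector orthogonal to [y - x]. *)
Lemma move_nonorthogonal x y : sform x y != 0%R -> exists2 h, h \in T &
  (x *m GLmx h = y)%R /\
  forall u, sform u x = sform u y -> (u *m GLmx h = u)%R.
Proof.
move=> hxy; exists (transvection (sform x y) (y - x)%R).
  exact: transvection_in_braid_group.
split=> [|u hu]; rewrite mul_transvection sformDr sformNr.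
  by rewrite sformxx subr0 F3_sqr // scale1r addrC subrK.
by rewrite hu subrr mulr0 scale0r addr0.
Qed.

Lemma move_through x y z : sform x z != 0%R -> sform z y != 0%R ->
  exists2 h, h \in T & (x *m GLmx h = y)%R /\
  forall u, sform u x = sform u z -> sform u z = sform u y ->
    (u *m GLmx h = u)%R.
Proof.
move=> /move_nonorthogonal[h hT [xh fh]] /move_nonorthogonal[k kT [zk fk]].
exists (h * k); first by rewrite groupM.
split=> [|u hu1 hu2]; first by rewrite GLmxM mulmxA xh.
by rewrite GLmxM mulmxA fh // fk.
Qed.

Lemma move_partner u x y : sform u x = 1%R -> sform u y = 1%R ->
  exists2 h, h \in T & [/\ u *m GLmx h = u, x *m GLmx h = y &
    forall v, sform v u = 0 -> sform v x = sform v y -> v *m GLmx h = v]%R.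
Proof.
(* The move passes through [x + c *: u], which pairs to [- c] with [x] on its left and to
   [sform x y + c] with [y] on its right; its pairing with [u] is that of [x], so [u] stays
   fixed. *)
move=> ux uy; have [c c0 hc] : exists2 c, c != 0%R & (sform x y + c != 0)%R.
  by case: (F3P (sform x y)) => ->; [exists 1%R|exists 1%R|exists (-1)%R].
have [||h hT [xh fh]] := @move_through x y (x + c *: u)%R.
- by rewrite sformDr sformxx add0r sformZr sformC ux mulrN1 oppr_eq0.
- by rewrite sformDl sformZl uy mulr1.
exists h => //; split=> // [|v vu vxy].
  by apply: fh; rewrite sformDr sformZr sformxx mulr0 addr0 ?ux ?uy.
by apply: fh; rewrite sformDr sformZr vu mulr0 addr0.
Qed.

(** Transitivity on vectors settles [x]; [move_partner] then corrects the image of [y] inside the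
    stabilizer of [std_row 0]. *)
Lemma hyperbolic_pair_trans x y : sform x y = 1%R ->
  exists2 h, h \in T & (x *m GLmx h = std_row 0)%R /\ (y *m GLmx h = std_row 2)%R.
Proof.
move=> hxy; have x0 : x != 0%R.
  by apply: contra_eq_neq hxy => ->; rewrite sform0l.
have [h hT e] := braid_group_trans x0.
set z := (y *m GLmx h^-1)%R.
have hxz : sform (std_row 0) z = 1%R.
  have /Sp43P <- : h \in Sp by exact: (subsetP braid_group_sub_Sp).
  by rewrite -e /z -mulmxA -GLmxM mulVg GLmx1 mulmx1.
have [|k kT [ek zk _]] := move_partner hxz (_ : sform (std_row 0) (std_row 2) = 1%R).
  by rewrite sformE !row_of_quadK; apply/eqP.
exists (h^-1 * k); first by rewrite groupM ?groupV.
rewrite !GLmxM !mulmxA zk; split=> //.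
by rewrite e -[(_ *m _ *m GLmx h^-1)%R]mulmxA -GLmxM mulgV GLmx1 mulmx1.
Qed.

Lemma std_row_span (v : rV) : exists a b c d : 'F_3,
  (v = a *: std_row 0 + b *: std_row 1 + c *: std_row 2 + d *: std_row 3)%R.
Proof.
have e := quad_of_rowK v; move: (quad_of_row v) e => [[[a b] c] d] <-.
exists a, b, c, d; apply/rowP; apply: forall_I4; rewrite !mxE /=.
all: by ring.
Qed.

(** An isometry [g] is corrected by elements of [T] until it fixes the four standard rows: [h]
    restores rows 0 and 2, then [k] restores row 1 and [l] restores row 3 without disturbing the
    earlier ones. *)
Lemma braid_group_Sp : braid_group = Sp.
Proof.
apply/val_inj/eqP; rewrite eqEsubset braid_group_sub_Sp /=.
apply/subsetP => g gS.
have e i j : (i < 4)%N -> (j < 4)%N ->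
  sform (std_row i) (std_row j) = (if j == i.+2 then 1 else if i == j.+2 then -1 else 0)%R.
  case: i => [|[|[|[|//]]]] _; case: j => [|[|[|[|//]]]] _;
  by rewrite sformE !row_of_quadK; apply/eqP.
have [|h hT [h0 h2]] := @hyperbolic_pair_trans (std_row 0 *m GLmx g)%R (std_row 2 *m GLmx g)%R.
  by move/Sp43P: (gS) => ->; rewrite e.
have hS : h \in Sp by exact: (subsetP braid_group_sub_Sp).
have /Sp43P ghP : g * h \in Sp by rewrite groupM.
pose x := (std_row 1 *m GLmx (g * h))%R; pose y := (std_row 3 *m GLmx (g * h))%R.
have gh0 : (std_row 0 *m GLmx (g * h) = std_row 0)%R by rewrite GLmxM mulmxA.
have gh2 : (std_row 2 *m GLmx (g * h) = std_row 2)%R by rewrite GLmxM mulmxA.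
have xy : sform x y = 1%R by rewrite ghP e.
have x0 : sform (std_row 0) x = 0%R by rewrite -gh0 ghP e.
have x2 : sform (std_row 2) x = 0%R by rewrite -gh2 ghP e.
have y0 : sform (std_row 0) y = 0%R by rewrite -gh0 ghP e.
have y2 : sform (std_row 2) y = 0%R by rewrite -gh2 ghP e.
(* The intermediate vector for moving [x] to [std_row 1] is orthogonal to rows 0 and 2, so that
   these stay fixed: row 3, or rows 1 + 3 if row 3 is orthogonal to [x]. *)
have [z [zx z1] [z0 z2]] : exists2 z, sform x z != 0%R /\ sform z (std_row 1) != 0%R
   & sform (std_row 0) z = 0%R /\ sform (std_row 2) z = 0%R.
  have [x3|x3] := eqVneq (sform x (std_row 3)) 0%R; last first.
    exists (std_row 3); rewrite ?(e 0 3 isT isT)%N ?(e 2 3 isT isT)%N ?(e 3 1 isT isT)%N; split=> //.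
  exists (std_row 1 + std_row 3)%R; rewrite !(sformDl, sformDr) !e ?x3 ?addr0 //; split=> //.
  (* Otherwise [x] would be orthogonal to all four standard rows, hence to [y]. *)
  apply: contra_eq_neq xy => x1; have [a [b [c [d ->]]]] := std_row_span y.
  rewrite !(sformDr, sformZr) x1 x3 (sformC (std_row 0)) (sformC (std_row 2)) x0 x2.
  by rewrite oppr0 !mulr0 !addr0.
have [k kT [xk fk]] := move_through zx z1.
have k0 : (std_row 0 *m GLmx k = std_row 0)%R by rewrite fk ?x0 ?z0 ?e.
have k2 : (std_row 2 *m GLmx k = std_row 2)%R by rewrite fk ?x2 ?z2 ?e.
have /Sp43P kP : k \in Sp by exact: (subsetP braid_group_sub_Sp).
have [|l lT [l1 yl fl]] := @move_partner (std_row 1) (y *m GLmx k)%R (std_row 3) _ (e 1 3 isT isT)%N.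
  by rewrite -xk kP xy.
have fin : g * (h * k * l) = 1.
  apply: GL_eqP => v.
  have ei i : (i < 4)%N -> (std_row i *m GLmx (g * (h * k * l)) = std_row i)%R.
    rewrite !mulgA (GLmxM _ l) (GLmxM _ k) !mulmxA.
    case: i => [|[|[|[|//]]]] _.
    - rewrite gh0 k0; apply: fl; first exact: (e 0 1 isT isT)%N.
      by rewrite [RHS](e 0 3 isT isT)%N -{1}k0 kP; exact: y0.
    - by rewrite xk l1.
    - rewrite gh2 k2; apply: fl; first exact: (e 2 1 isT isT)%N.
      by rewrite [RHS](e 2 3 isT isT)%N -{1}k2 kP; exact: y2.
    - exact: yl.
  have [a [b [c [d ->]]]] := std_row_span v.
  rewrite GLmx1 mulmx1 !mulmxDl -!scalemxAl.
  rewrite (ei 0 isT)%N (ei 1 isT)%N (ei 2 isT)%N.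
  congr (_ + _ *: _)%R; exact: (ei 3 isT)%N.
by rewrite -(mulgK (h * k * l) g) fin mul1g groupV !groupM.
Qed.

(** * Classes of systems *)

Section BraidAction.
Variables (gT : finGroupType) (m : nat).
Implicit Type t : m.-tuple gT.

Lemma ent_tconj t g k : ent (tconj t g) k = ent t k ^ g.
Proof.
rewrite /ent; have [km|km] := ltnP k m.
  by rewrite nth_mktuple1 (tnth_nth 1).
by rewrite !nth_default ?size_tuple ?conj1g.
Qed.

Lemma hur_tconj j t g : hur j (tconj t g) = tconj (hur j t) g.
Proof.
rewrite /hur; case: ifP => // _; apply: eq_from_tnth => i.
rewrite !tnth_mktuple !ent_tconj; case: (_ == j.-2).
  by rewrite [RHS]conjJg conjVg.
by case: (_ == j.-1).
Qed.

Lemma tconjM t g h : tconj t (g * h) = tconj (tconj t g) h.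
Proof. by apply: eq_from_tnth => i; rewrite !tnth_mktuple conjgM. Qed.

Lemma tclass_tconj (G : {group gT}) t g :
  g \in G -> tclass G (tconj t g) = tclass G t.
Proof.
move=> gG; apply/setP => u; apply/imsetP/imsetP => [[h hG ->]|[h hG ->]].
  by exists (g * h); rewrite ?groupM ?tconjM.
by exists (g^-1 * h); rewrite ?groupM ?groupV // -tconjM mulKVg.
Qed.

Lemma mem_tclass (G : {group gT}) t : t \in tclass G t.
Proof.
apply/imsetP; exists 1 => //.
by apply: eq_from_tnth => i; rewrite tnth_mktuple conjg1.
Qed.

Lemma Pset_beta_tclass (G : {group gT}) j t :
  Pset (beta gT m j) (tclass G t) = tclass G (hur j t).
Proof.
rewrite permE /tclass -imset_comp; apply: eq_imset => g /=.
by rewrite permE hur_tconj.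
Qed.

Lemma PsetM (p q : {perm m.-tuple gT}) : Pset (p * q) = Pset p * Pset q.
Proof.
apply/permP => X; rewrite permM !permE -imset_comp.
by apply: eq_imset => x /=; rewrite permM.
Qed.

Lemma PsetV (p : {perm m.-tuple gT}) : Pset p^-1 = (Pset p)^-1.
Proof.
apply/eqP; rewrite eq_sym eq_invg_mul -PsetM mulgV; apply/eqP/permP => X.
by rewrite permE perm1 -[RHS]imset_id; apply: eq_imset => x; rewrite perm1.
Qed.

End BraidAction.

Lemma system_of_opp q : system_of (quad_opp q) = system_of q.
Proof.
rewrite /system_of /lookup quad_oppK.
rewrite (eq_find (a2 := fun p => (p.1 == q) || (p.1 == quad_opp q))); last first.
  by move=> p; rewrite orbC.
move: (find _ _) => n.
have [ns|ns] := ltnP n (size systems).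
  by rewrite (set_nth_default (q, [::])).
by rewrite !nth_default.
Qed.

(** * Labelling the classes of systems in G by vectors *)

Section Classes.
Variables (gT : finGroupType) (G : {group gT}) (s1 s2 : gT).
Hypotheses (defG : G :=: <<[set s1; s2]>>) (neq12 : s1 != s2).
Hypothesis braid : s1 * s2 * s1 = s2 * s1 * s2.
Hypothesis inv : (s1 * s2 * s1) ^+ 2 = 1.

Local Notation a := (s1 * s2 * s1).
Local Notation b := (s1 * s2).

Lemma b_cube : b ^+ 3 = 1.
Proof.
have -> : b ^+ 3 = a * (s2 * s1 * s2) by rewrite !expgS expg0 mulg1 !mulgA.
by rewrite -braid -expg2. Qed.

Lemma mem_s1 : s1 \in G. Proof. by rewrite defG mem_gen // !inE eqxx. Qed.
Lemma mem_s2 : s2 \in G. Proof. by rewrite defG mem_gen // !inE eqxx orbT. Qed.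

Lemma eval_in w : eval a b w \in G.
Proof.
apply: group_prod => -[[]|] _ /=; rewrite ?groupV ?groupM ?mem_s1 ?mem_s2 //.
Qed.

Lemma conj_systemsP t u : conj_systems t u ->
  tclass G (eval_tuple a b t) = tclass G (eval_tuple a b u).
Proof.
case/hasP => c _ /allP h; rewrite -(tclass_tconj _ (eval_in c)).
congr (tclass G _); apply: eq_from_tnth => i; rewrite !tnth_mktuple.
have /h : val i \in iota 0 6 by rewrite mem_iota ltn_ord.
move/(eval_eq inv b_cube); rewrite !eval_cat (@eval_inv _ a b inv) => <-.
by rewrite /conjg.
Qed.

Definition system_class (v : rV) : {set 6.-tuple gT} :=
  tclass G (eval_tuple a b (system_of (quad_of_row v))).
Local Notation X0 := (tclass G [tuple s1; s2; s1; s1; s2; s1]).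
Local Notation r j := (Pset (beta gT 6 j)).

Lemma system_classN v : system_class (- v)%R = system_class v.
Proof. by rewrite /system_class quad_of_rowN system_of_opp. Qed.

Lemma system_class_tau j v : (2 <= j <= 6)%N -> v != 0%R ->
  r j (system_class v) = system_class (v *m GLmx (tau j))%R.
Proof.
move=> hj v0; rewrite Pset_beta_tclass -eval_word_hur // /system_class.
rewrite quad_of_tau; apply: conj_systemsP.
move/allP: system_equivariant => /(_ _ (quad_of_row_in v)).
rewrite quad_of_row0 (negPf v0) => /allP; apply.
by rewrite mem_iota.
Qed.

Definition base_row : rV := row_of_quad (1, 1, 1, 1)%R.

Lemma base_class : X0 = system_class base_row.
Proof.
rewrite /system_class row_of_quadK -(conj_systemsP system_base).
congr (tclass G _).
have e1 : eval a b [:: Some false; None] = s1.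
  by rewrite /eval !big_cons big_nil /= mulg1 mulKg.
have e2 : eval a b [:: None; Some false] = s2.
  by rewrite /eval !big_cons big_nil /= mulg1 braid -(mulgA s2) mulgK.
by apply: eq_from_tnth => -[[|[|[|[|[|[|//]]]]]] i]; rewrite tnth_mktuple (tnth_nth 1) /= ?e1 ?e2.
Qed.

(** After [beta_2] the second and third entries are both [s1], while in the base system they are
    [s2] and [s1]; a conjugation matching both forces [s1 = s2]. *)
Lemma beta2_moves_base : r 2 X0 != X0.
Proof.
rewrite Pset_beta_tclass; apply: contra neq12 => /eqP e.
have := mem_tclass G (hur 2 [tuple s1; s2; s1; s1; s2; s1]).
rewrite e => /imsetP[g _ h].
have h1 := congr1 (fun t => tnth t (@Ordinal 6 1 isT)) h.
have h2 := congr1 (fun t => tnth t (@Ordinal 6 2 isT)) h.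
move: h1 h2; rewrite /hur /= !tnth_mktuple /= !(tnth_nth 1) /= => h1 h2.
by apply/eqP; apply: (conjg_inj g); rewrite -h2.
Qed.

End Classes.

(** * Permutations of order 3 *)

Section OrderThree.
Variables (U : finType) (Z : {set U}) (p : {perm U}).
Hypotheses (pZ : {homo p : x / x \in Z}) (p3 : p ^+ 3 = 1).

Local Notation fixed := [set x in Z | p x == x].
Local Notation moved := [set x in Z | p x != x].

Lemma porbit_fixed x : p x = x -> porbit p x = [set x].
Proof.
move=> px; apply/setP => y; rewrite inE; apply/porbitP/eqP => [[i ->]|->].
  by elim: i => [|i IH]; rewrite ?expg0 ?perm1 // expgSr permM IH.
by exists 0%N; rewrite expg0 perm1.
Qed.

Lemma card_porbit_order3 x : #|porbit p x| = if p x == x then 1%N else 3%N.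
Proof.
case: eqP => [/porbit_fixed->|px]; first by rewrite cards1.
have : #|porbit p x| %| 3.
  rewrite porbitE; apply: dvdn_trans (dvdn_orbit _ _ _) _.
  by rewrite -[#|_|]/#[p] order_dvdn p3.
rewrite dvdn_divisors // !inE => /orP[]/eqP // c1.
have [y e] : exists y, porbit p x = [set y] by apply/cards1P/eqP.
have := porbit_id p x; have := mem_porbit p 1 x.
by rewrite expg1 e !inE => /eqP pxy /eqP xy; case: px; rewrite pxy.
Qed.

Lemma card_fixed_porbits :
  #|[set porbit p x | x in Z & #|porbit p x| == 1%N]| = #|fixed|.
Proof.
have -> : [set x in Z | #|porbit p x| == 1%N] = fixed.
  by apply/setP => x; rewrite !inE card_porbit_order3; case: (p x == x).
rewrite card_in_imset // => x y; rewrite !inE => /andP[_ /eqP px] /andP[_ /eqP py].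
by rewrite !porbit_fixed // => /set1_inj.
Qed.

(** Powers of [p] keep a moved point moved, so the moved points are partitioned into full cycles,
    all of size 3. *)
Lemma card_moved_porbits :
  (3 * #|[set porbit p x | x in Z & #|porbit p x| == 3%N]| = #|moved|)%N.
Proof.
have -> : [set x in Z | #|porbit p x| == 3%N] = moved.
  by apply/setP => x; rewrite !inE card_porbit_order3; case: (p x == x).
have homo x i : x \in moved -> (p ^+ i) x \in moved.
  elim: i => [|i IH] xm; first by rewrite expg0 perm1.
  move: (IH xm); rewrite expgSr permM !inE => /andP[hZ hm].
  by rewrite pZ // (inj_eq perm_inj).
have -> : [set porbit p x | x in moved] = preim_partition (porbit p) moved.
  apply: eq_in_imset => x xm; apply/setP => y; rewrite inE eq_porbit_mem.
  rewrite porbit_sym; apply/idP/andP => [yx|[]//]; split=> //.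
  by move: yx; rewrite porbit_sym => /porbitP[i ->]; apply: homo.
rewrite mulnC; apply/esym; apply: card_uniform_partition (preim_partitionP _ _).
move=> A /imsetP[x xm ->].
have -> : [set y in moved | porbit p x == porbit p y] = porbit p x.
  apply/setP => y; rewrite inE eq_porbit_mem.
  apply/andP/idP => [[_]|yx]; first by rewrite porbit_sym.
  split; last by rewrite porbit_sym.
  by case/porbitP: yx => i ->; apply: homo.
by move: xm; rewrite card_porbit_order3 inE => /andP[_ /negPf->].
Qed.

Lemma order3_cycle_type n k : #|fixed| = n -> #|Z| = (n + 3 * k)%N ->
  cycle_type_1_3 Z p n k /\ ncycles Z p = (n + k)%N.
Proof.
move=> hn hZ; have hk : #|[set porbit p x | x in Z & #|porbit p x| == 3%N]| = k.
  apply/eqP; rewrite -(eqn_pmul2l (m := 3%N)) // card_moved_porbits.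
  rewrite -(eqn_add2l n) -hZ -hn -(cardsID [set x | p x == x] Z).
  by apply/eqP; congr (_ + _)%N; apply: eq_card => x; rewrite !inE // andbC.
split.
  move=> l; rewrite /ncycles_len; case: (eqVneq l 1%N) => [->|l1].
    by rewrite card_fixed_porbits.
  case: (eqVneq l 3%N) => [->|l3]; first exact: hk.
  apply/eqP; rewrite cards_eq0; apply/eqP/setP => A; rewrite inE.
  apply/imsetP => -[x]; rewrite inE card_porbit_order3 => /andP[_ /eqP e] _.
  by move: l1 l3; rewrite -e; case: (p x == x).
pose F l := [set porbit p x | x in Z & #|porbit p x| == l].
(* Every cycle in [Z] has length 1 or 3, and the two families are disjoint. *)
have -> : (n + k = #|F 1%N :|: F 3%N| + #|F 1%N :&: F 3%N|)%N.
  by rewrite cardsUI card_fixed_porbits hn hk.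
have -> : F 1%N :&: F 3%N = set0.
  apply/setP => X; rewrite !inE; apply/andP => -[/imsetP[x hx ->] /imsetP[y hy e]].
  by move: hx hy; rewrite !inE -e => /andP[_ /eqP->] /andP[].
rewrite /ncycles cards0 addn0; congr #|pred_of_set _|; apply/setP => X; rewrite inE.
apply/imsetP/orP => [[x xZ ->]|[]/imsetP[x + ->]]; last 2 first.
- by rewrite inE => /andP[xZ _]; exists x.
- by rewrite inE => /andP[xZ _]; exists x.
by case: (eqVneq (p x) x) => px; [left|right]; apply: imset_f;
  rewrite inE xZ card_porbit_order3 ?px ?eqxx // (negPf px).
Qed.

End OrderThree.

(** * The action on lines *)

Lemma mul_GLmx_eq0 (v : rV) g : (v *m GLmx g == 0)%R = (v == 0)%R.
Proof.
apply/eqP/eqP => [e|->]; last by rewrite mul0mx.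
by rewrite -[v]mulmx1 -GLmx1 -(mulgV g) GLmxM mulmxA e mul0mx.
Qed.

(** Otherwise [w] is orthogonal to the hyperplane of [v]. Projecting any [x] to that hyperplane
    along a partner [u] of [v] shows that [w - sform u w *: v] lies in the radical, so [w] is 0, [v]
    or [- v]. *)
Lemma sform_separates (v w : rV) : w != 0%R -> w != v -> w != (- v)%R ->
  exists2 u, sform u v = 0%R & sform u w != 0%R.
Proof.
move=> w0 wv wNv; have [v0|v0] := eqVneq v 0%R.
  by have [u uw] := sform_nondeg w0; exists u; rewrite ?uw // v0 sform0r.
have [u uv] := sform_nondeg v0.
suff /existsP[x /andP[/eqP]] : [exists x, (sform x v == 0%R) && (sform x w != 0%R)].
  by exists x.
apply: contraT => /existsPn h.
have e x : sform x (w - sform u w *: v)%R = 0%R.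
  have := h (x - sform x v *: u)%R.
  rewrite !(sformDl, sformNl, sformZl) uv mulr1 subrr eqxx /= negbK subr_eq0 => /eqP e.
  by rewrite sformDr sformNr sformZr e mulrC subrr.
have /eqP : (w - sform u w *: v)%R = 0%R.
  apply/eqP; apply: contraT => /sform_nondeg[x]; by rewrite e.
rewrite subr_eq0 => /eqP we; move: w0 wv wNv; rewrite we.
by case: (F3P (sform u w)) => ->; rewrite ?scale0r ?scale1r ?scaleN1r eqxx.
Qed.

Lemma center_SpP (g : GL43) : g \in Sp ->
  reflect (forall v : rV, v *m GLmx g = v \/ v *m GLmx g = - v)%R (g \in 'Z(Sp)).
Proof.
move=> gS; apply: (iffP idP) => [/centerP[_ cg] v|h].
  have [->|v0] := eqVneq v 0%R; first by left; rewrite mul0mx.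
  (* Evaluating the commutation with the transvection along [v] at this [x] shows that [g] sends [v]
     to a multiple of [v]. *)
  have [x xv] := sform_nondeg v0.
  have e := cg _ (transvection_Sp 1%R v).
  have := congr1 (fun h => (x *m GLmx h)%R) e.
  rewrite /= !GLmxM !mulmxA !mul_transvection mulmxDl -scalemxAl xv !mul1r scale1r.
  move/addrI/esym => e'; have := v0; rewrite -(mul_GLmx_eq0 v g).
  rewrite e'; case: (F3P (sform (x *m GLmx g)%R v)) => -> ; first by rewrite scale0r eqxx.
    by left; rewrite scale1r.
  by right; rewrite scaleN1r.
apply/centerP; split=> // k; rewrite -braid_group_Sp.
suff /subsetP sT : T \subset 'C[g] by move/sT/cent1P.
rewrite gen_subG; apply/subsetP => _ /imsetP[j _ ->].
apply/cent1P/commgP/conjg_fixP.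
rewrite /tau transvectionJ //.
by case: (h (braid_root j)) => ->; rewrite ?transvectionN.
Qed.

(** * An equivariant labelling by vectors and its injectivity up to sign *)

Section LineAction.
Variables (Omega : finType) (f : rV -> Omega) (r : nat -> {perm Omega}) (v0 : rV).
Hypothesis fN : forall v : rV, f (- v)%R = f v.
Hypothesis f_tau : forall j (v : rV), (2 <= j <= 6)%N -> v != 0%R ->
  r j (f v) = f (v *m GLmx (tau j))%R.
Hypothesis v0_e0 : sform v0 (std_row 0) != 0%R.
Hypothesis f_v0 : r 2 (f v0) != f v0.

Local Notation Y := (f @: [set v | v != 0%R]).

(** The matrices that preserve coincidences of [f] form a group, and it contains each [tau j]
    because [r j] is a function of the label. *)
Lemma f_eq_stable h v w : h \in T -> v != 0%R -> w != 0%R ->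
  f v = f w -> f (v *m GLmx h)%R = f (w *m GLmx h)%R.
Proof.
pose P (h : GL43) := [forall v, forall w, [&& v != 0, w != 0 & f v == f w]%R ==>
  (f (v *m GLmx h) == f (w *m GLmx h))%R].
have PP k : reflect (forall v w, v != 0%R -> w != 0%R -> f v = f w ->
    f (v *m GLmx k)%R = f (w *m GLmx k)%R) (P k).
  apply: (iffP forallP) => [H x y x0 y0 e|H x].
    by move: (H x) => /forallP/(_ y); rewrite x0 y0 e eqxx /= => /eqP.
  by apply/forallP => y; apply/implyP => /and3P[x0 y0 /eqP e]; apply/eqP/H.
have Pg : group_set [set k | P k].
  apply/group_setP; split; first by rewrite inE; apply/PP => *; rewrite GLmx1 !mulmx1.
  move=> k l; rewrite !inE => /PP hk /PP hl; apply/PP => x y x0 y0 e.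
  by rewrite GLmxM !mulmxA; apply: hl; rewrite ?mul_GLmx_eq0 //; apply: hk.
move=> hT; suff /subsetP/(_ h hT) : T \subset Group Pg by rewrite inE => /PP; apply.
rewrite gen_subG; apply/subsetP => _ /imsetP[j + ->]; rewrite inE => j2.
have hj : (2 <= j <= 6)%N by rewrite j2 -ltnS ltn_ord.
by rewrite inE; apply/PP => x y x0 y0 e; rewrite -!f_tau // e.
Qed.

Lemma sform_neq0 x y : sform x y != 0%R -> x != 0%R /\ y != 0%R.
Proof.
by move=> h; split; apply: contraNneq h => ->; rewrite ?sform0l ?sform0r.
Qed.

(** One coincidence on a nonorthogonal pair spreads to all hyperbolic pairs by transitivity. Among
    these is [v0] with its image under [tau 2], since their pairing is
    [(sform v0 (std_row 0))^2 = 1]; this contradicts [f_v0]. *)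
Lemma f_nonorthogonal x y : sform x y != 0%R -> f x != f y.
Proof.
have fZ (c : 'F_3) (v : rV) : c != 0%R -> f (c *: v)%R = f v.
  by case: (F3P c) => ->; rewrite ?eqxx // ?scale1r ?scaleN1r.
move=> xy; apply: contra f_v0 => /eqP e.
have [x0 y0] := sform_neq0 xy.
have e02 : f (std_row 0) = f (std_row 2).
  have [|h hT [<- <-]] := @hyperbolic_pair_trans x (sform x y *: y)%R.
    by rewrite sformZr F3_sqr.
  apply: f_eq_stable => //; last by rewrite fZ.
  by rewrite scaler_eq0 negb_or xy.
have tau2 x' : (x' *m GLmx (tau 2) = x' + sform x' (std_row 0) *: std_row 0)%R.
  by rewrite mul_transvection mul1r.
have [v00 _] := sform_neq0 v0_e0.
have [|h hT [h0 h2]] := @hyperbolic_pair_trans v0 (v0 *m GLmx (tau 2))%R.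
  by rewrite tau2 sformDr sformxx add0r sformZr F3_sqr.
have inv0 (z : rV) : z = (z *m GLmx h *m GLmx h^-1)%R.
  by rewrite -mulmxA -GLmxM mulgV GLmx1 mulmx1.
rewrite f_tau // [X in f X == _]inv0 h2 [X in _ == f X]inv0 h0.
apply/eqP/f_eq_stable; first by rewrite groupV.
- by rewrite -h2 !mul_GLmx_eq0.
- by rewrite -h0 mul_GLmx_eq0.
- exact: esym.
Qed.

(** A transvection along some [u] orthogonal to [v] but not to [w] fixes [v] and moves [w] to a
    vector not orthogonal to [w]; stability of the coincidence would give both the same label. *)
Lemma f_inj v w : v != 0%R -> w != 0%R -> f v = f w -> w = v \/ w = (- v)%R.
Proof.
move=> vn0 w0 e; have [->|wv] := eqVneq w v; first by left.
have [->|wNv] := eqVneq w (- v)%R; first by right.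
have [u uv uw] := sform_separates w0 wv wNv.
pose t := transvection 1%R u.
have /f_eq_stable/(_ vn0 w0 e) : t \in T by exact: transvection_in_braid_group.
rewrite !mul_transvection !mul1r (sformC u v) uv oppr0 scale0r addr0 => e'.
have /f_nonorthogonal/eqP : sform w (w + sform w u *: u)%R != 0%R.
  by rewrite sformDr sformxx add0r sformZr F3_sqr // sformC oppr_eq0.
by rewrite -e' e.
Qed.

Lemma card_f_imset (A : {set rV}) : 0%R \notin A ->
  (forall v : rV, v \in A -> (- v)%R \in A) ->
  #|A| = (2 * #|f @: A|)%N.
Proof.
move=> A0 AN; have nz v : v \in A -> v != 0%R by move=> vA; apply: contraNneq A0 => <-.
rewrite mulnC -[#|A|]sum1_card (partition_big_imset f) /= -sum_nat_const.
apply: eq_bigr => _ /imsetP[v vA ->].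
rewrite sum1_card (eq_card (B := mem [set v; (- v)%R])); last first.
  move=> w; rewrite unfold_in !inE.
  apply/andP/orP => [[wA /eqP e]|[]/eqP->]; last 2 first.
  - by [].
  - by rewrite AN // fN.
  by case: (f_inj (nz _ vA) (nz _ wA) (esym e)) => ->; [left|right].
rewrite cards2; suff -> : v != (- v)%R by [].
have := nz _ vA; apply: contra; rewrite -subr_eq0 opprK.
by rewrite -{1 2}[v]scale1r -scalerDl scaler_eq0.
Qed.

Definition represents (p : {perm Omega}) (h : GL43) :=
  forall v : rV, v != 0%R -> p (f v) = f (v *m GLmx h)%R.

Lemma represents_tau j : (2 <= j <= 6)%N -> represents (r j) (tau j).
Proof. by move=> hj v; apply: f_tau. Qed.

Lemma represents1 : represents 1 1.
Proof. by move=> v _; rewrite perm1 GLmx1 mulmx1. Qed.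

Lemma representsM p q g h :
  represents p g -> represents q h -> represents (p * q) (g * h).
Proof.
move=> pg qh v vn0.
by rewrite permM pg // qh ?mul_GLmx_eq0 // GLmxM mulmxA.
Qed.

Lemma representsV p g : represents p g -> represents p^-1 g^-1.
Proof.
move=> pg v vn0; apply: (@perm_inj _ p); rewrite permKV pg ?mul_GLmx_eq0 //.
by rewrite -mulmxA -GLmxM mulVg GLmx1 mulmx1.
Qed.

(* Well defined by injectivity of [f] up to sign; the identity off the image of
   [f]. *)
Definition line_act (X : Omega) (g : GL43) : Omega :=
  if [pick v | (v != 0%R) && (f v == X)] is Some v then f (v *m GLmx g)%R else X.

Lemma f_Sp_stable (g : GL43) v w : v != 0%R -> w != 0%R -> f v = f w ->
  f (v *m GLmx g)%R = f (w *m GLmx g)%R.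
Proof.
by move=> vn0 w0 /f_inj[]// ->; rewrite ?mulNmx ?fN.
Qed.

Lemma line_actE v g : v != 0%R -> line_act (f v) g = f (v *m GLmx g)%R.
Proof.
move=> vn0; rewrite /line_act; case: pickP => [w /andP[w0 /eqP e]|/(_ v)].
  exact: f_Sp_stable.
by rewrite vn0 eqxx.
Qed.

Lemma in_lines v : v != 0%R -> f v \in Y.
Proof. by move=> vn0; apply: imset_f; rewrite inE. Qed.

Lemma line_act_out X g : X \notin Y -> line_act X g = X.
Proof.
rewrite /line_act; case: pickP => // v /andP[vn0 /eqP<-].
by rewrite in_lines.
Qed.

Lemma linesP X : reflect (exists2 v, v != 0%R & X = f v) (X \in Y).
Proof.
by apply: (iffP imsetP) => -[v]; rewrite ?inE => vn0 ->; exists v; rewrite ?inE.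
Qed.

Lemma line_act1 : line_act^~ 1 =1 id.
Proof.
move=> X; have [/linesP[v vn0 ->]|] := boolP (X \in Y); last exact: line_act_out.
by rewrite line_actE // GLmx1 mulmx1.
Qed.

Lemma line_actM X : act_morph line_act X.
Proof.
move=> g h; have [/linesP[v vn0 ->]|XY] := boolP (X \in Y).
  by rewrite !line_actE ?mul_GLmx_eq0 // GLmxM mulmxA.
by rewrite !line_act_out.
Qed.

Definition line_action := TotalAction line_act1 line_actM.
Local Notation phi := (actperm line_action).

Lemma phiE v g : v != 0%R -> phi g (f v) = f (v *m GLmx g)%R.
Proof. by move=> vn0; rewrite actpermE /= line_actE. Qed.

Lemma phi_out X g : X \notin Y -> phi g X = X.
Proof. by move=> XY; rewrite actpermE /= line_act_out. Qed.

Lemma phi_ker g : (phi g = 1) <-> (forall v : rV, v *m GLmx g = v \/ v *m GLmx g = - v)%R.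
Proof.
split=> [e v|h].
  have [->|vn0] := eqVneq v 0%R; first by left; rewrite mul0mx.
  apply: f_inj => //; first by rewrite mul_GLmx_eq0.
  by rewrite -phiE // e perm1.
apply/permP => X; rewrite perm1; have [/linesP[v vn0 ->]|XY] := boolP (X \in Y).
  by rewrite phiE //; case: (h v) => ->.
exact: phi_out.
Qed.

Lemma phi_Sp_isog : phi @* Sp \isog PSp43.
Proof.
have e : 'ker_Sp phi = 'Z(Sp).
  apply/setP => g; apply/setIP/idP => [[gS gk]|gZ].
    by apply/(center_SpP gS)/phi_ker; exact: (mker gk).
  have gS : g \in Sp by case/setIP: gZ.
  by split=> //; apply/kerP; rewrite ?inE //; apply/phi_ker/(center_SpP gS).
have : Sp / 'Z(Sp) \isog phi @* Sp by rewrite -e first_isog_loc ?subsetT.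
rewrite isog_sym; exact.
Qed.

(** Both permutations are the identity off [Y], so agreement on the lines suffices. *)
Lemma restr_phi (p : {perm Omega}) h : represents p h ->
  p \in 'N(Y | 'P) /\ restr_perm Y p = phi h.
Proof.
move=> H; have pN : p \in 'N(Y | 'P).
  rewrite !inE; apply/subsetP => _ /linesP[v vn0 ->].
  by rewrite inE /= /aperm H // in_lines ?mul_GLmx_eq0.
split=> //; apply/permP => X; have [XY|XY] := boolP (X \in Y).
  by rewrite restr_permE //; case/linesP: XY => v vn0 ->; rewrite H // phiE.
by rewrite phi_out // (out_perm (restr_perm_on _ _)).
Qed.

(** Serves both braid groups: the first hypothesis bounds the image above by that of [Sp], the
    second supplies the images of the generators [tau j]. Transitivity on vectors then gives the
    orbit. *)
Lemma restr_generated (A : {set {perm Omega}}) :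
  (forall p, p \in A -> exists2 h, h \in T & represents p h) ->
  (forall j, (2 <= j <= 6)%N ->
     exists2 p, p \in <<A>> & restr_perm Y p = phi (tau j)) ->
  restr_perm Y @* <<A>> = phi @* Sp /\ orbit 'P <<A>> (f v0) = Y.
Proof.
move=> hA hgen; have AN : A \subset 'N(Y | 'P).
  by apply/subsetP => p /hA[h _ /restr_phi[]].
have genN : <<A>> \subset 'N(Y | 'P) by rewrite gen_subG.
have e : restr_perm Y @* <<A>> = phi @* Sp.
  rewrite -braid_group_Sp; apply/eqP; rewrite eqEsubset; apply/andP; split.
    rewrite morphim_gen // gen_subG; apply/subsetP => _ /morphimP[p _ pA ->].
    have [h hT /restr_phi[_ ph]] := hA p pA.
    by rewrite /= ph; apply: mem_morphim; rewrite ?inE.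
  rewrite morphim_gen ?subsetT // gen_subG.
  apply/subsetP => _ /morphimP[_ _ /imsetP[j + ->] ->]; rewrite inE => j2.
  have [|p pA ph] := hgen j; first by rewrite j2 -ltnS ltn_ord.
  by rewrite /= -ph; apply: mem_morphim => //; exact: (subsetP genN).
split=> //; have [v00 _] := sform_neq0 v0_e0.
apply/eqP; rewrite eqEsubset acts_sub_orbit // in_lines //=.
apply/subsetP => _ /linesP[v vn0 ->].
have [h hT ->] := braid_group_trans vn0.
have [k kT e0] := braid_group_trans v00.
have : phi (k^-1 * h) \in restr_perm Y @* <<A>>.
  by rewrite e -braid_group_Sp mem_morphim ?inE // groupM ?groupV.
case/morphimP=> p pN pA ep; apply/orbitP; exists p => //=.
rewrite /aperm -(restr_permE pN) ?in_lines // -ep phiE // e0 -mulmxA -GLmxM.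
by rewrite mulKVg.
Qed.

Lemma card_lines : #|Y| = 40.
Proof.
have : (2 * #|Y| = 80)%N.
  rewrite -card_f_imset; last 2 first.
  - by rewrite inE eqxx.
  - by move=> v; rewrite !inE oppr_eq0.
  have := cardsC1 (0%R : rV); rewrite card_mx card_Fp // => e.
  by rewrite -[RHS]e; apply: eq_card => v; rewrite !inE.
lia.
Qed.

(** The three level sets of [sform^~ w] are translates of this hyperplane by multiples of [u], so it
    contains a third of the 81 vectors. *)
Lemma card_orthogonal w : w != 0%R -> #|[set v : rV | sform v w == 0%R]| = 27.
Proof.
move=> w0; have [u uw] := sform_nondeg w0.
have : #|{: rV}| = (3 * #|[set v : rV | sform v w == 0%R]|)%N.
  rewrite -[in LHS]sum1_card (partition_big (sform^~ w) xpredT) //=.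
  transitivity (\sum_(c : 'F_3) #|[set v : rV | sform v w == 0%R]|)%N; last first.
    by rewrite sum_nat_const card_Fp.
  apply: eq_bigr => c _.
  rewrite sum1dep_card -[RHS](card_imset _ (@addrI _ (c *: u)%R)) /=.
  apply: eq_card => v; rewrite [LHS]inE.
  apply/eqP/imsetP => [vc|[x + ->]].
    exists (v - c *: u)%R; last by rewrite addrC subrK.
    by rewrite inE sformDl sformNl sformZl uw mulr1 vc subrr.
  by rewrite inE sformDl sformZl uw mulr1 => /eqP->; rewrite addr0.
rewrite card_mx card_Fp //; lia.
Qed.

(** The fixed lines are those in the hyperplane orthogonal to [w], (27 - 1) / 2 = 13 in number; the
    other 27 lines form nine 3-cycles because a transvection has cube 1. *)
Lemma phi_transvection_cycles c w : c != 0%R -> w != 0%R ->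
  cycle_type_1_3 Y (phi (transvection c w)) 13 9 /\
  ncycles Y (phi (transvection c w)) = 22.
Proof.
move=> c0 w0; set t := transvection c w.
apply: (@order3_cycle_type _ _ _ _ _ 13 9).
- by move=> _ /linesP[v vn0 ->]; rewrite phiE // in_lines // mul_GLmx_eq0.
- rewrite -morphX ?inE // (_ : t ^+ 3 = 1) ?morph1 //.
  rewrite expgS expg2 !transvectionM.
  have -> : (c + (c + c) = 0)%R by case: (F3P c) => ->; apply/eqP.
  exact: transvection0.
- have -> : [set X in Y | phi t X == X] = f @: ([set v : rV | sform v w == 0%R] :\ 0%R).
    apply/setP => X; apply/idP/imsetP => [|[v]].
      rewrite inE => /andP[/linesP[v vn0 ->]]; rewrite phiE // => /eqP e.
      exists v => //; rewrite !inE vn0 /=.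
      have := f_inj _ vn0 e; rewrite mul_GLmx_eq0 => /(_ vn0).
      rewrite mul_transvection => -[|] e'.
      + move/eqP: (esym e'); rewrite -subr_eq0 addrC addKr scaler_eq0 (negPf w0) orbF.
        by rewrite mulf_eq0 (negPf c0).
      (* If [v] goes to [- v], pairing with [w] gives [sform v w = - sform v w], hence 0. *)
      + have /(congr1 (sform^~ w)) := e'.
        rewrite /= sformNl sformDl sformZl sformxx mulr0 addr0.
        by case: (F3P (sform v w)) => ->.
    rewrite !inE => /andP[vn0 /eqP vw] ->; rewrite in_lines //= phiE //.
    by rewrite mul_transvection vw mulr0 scale0r addr0.
  have : (2 * #|f @: ([set v : rV | sform v w == 0%R] :\ 0%R)| = 26)%N.
    rewrite -card_f_imset; last 2 first.
    - by rewrite !inE eqxx.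
    - by move=> v; rewrite !inE oppr_eq0 sformNl oppr_eq0.
    have := cardsD1 (0%R : rV) [set v : rV | sform v w == 0%R].
    by rewrite card_orthogonal // inE sform0l eqxx => -[e]; exact: esym e.
  lia.
- by rewrite card_lines.
Qed.

End LineAction.

(** * The orbit of length 40 *)

Section Systems.
Variables (gT : finGroupType) (m : nat).
Implicit Type t : m.-tuple gT.

Lemma ent_hur j t k : (1 < j <= m)%N ->
  ent (hur j t) k = if k == j.-2 then ent t j.-1 ^ (ent t j.-2)^-1
                    else if k == j.-1 then ent t j.-2 else ent t k.
Proof.
move=> hj; rewrite /hur hj {1}/ent; have [km|km] := ltnP k m.
  by rewrite nth_mktuple1 /= (tnth_nth 1).
rewrite nth_default ?size_tuple //.
have -> : (k == j.-2) = false by lia.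
have -> : (k == j.-1) = false by lia.
by rewrite /ent nth_default ?size_tuple.
Qed.

Lemma hur_in (H : {group gT}) j t : (1 < j <= m)%N ->
  (forall k, ent (hur j t) k \in H) <-> (forall k, ent t k \in H).
Proof.
move=> hj; split=> h k; last first.
  by rewrite ent_hur //; case: ifP => _; [rewrite groupJ ?groupV|case: ifP].
have nj : (j.-1 == j.-2) = false by lia.
have h2 : ent t j.-2 \in H by have := h j.-1; rewrite ent_hur // nj eqxx.
have h1 : ent t j.-1 \in H.
  by have := h j.-2; rewrite ent_hur // eqxx groupJr ?groupV.
have := h k; rewrite ent_hur //; case: eqP => [->|_ ] //; case: eqP => [->|_] //.
Qed.

Lemma gen_entries_sub (H : {group gT}) t :
  (<<[set tnth t i | i : 'I_m]>> \subset H) <-> (forall k, ent t k \in H).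
Proof.
rewrite gen_subG; split=> [/subsetP h k|h].
  (* Past the end [ent] returns 1, which lies in every subgroup. *)
  have [km|km] := ltnP k m; last by rewrite /ent nth_default ?size_tuple.
  by apply: h; apply/imsetP; exists (Ordinal km); rewrite // (tnth_nth 1).
by apply/subsetP => _ /imsetP[i _ ->]; rewrite (tnth_nth 1); apply: h.
Qed.

Lemma gen_hur j t : (1 < j <= m)%N ->
  <<[set tnth (hur j t) i | i : 'I_m]>> = <<[set tnth t i | i : 'I_m]>>.
Proof.
move=> hj; apply/eqP; rewrite eqEsubset.
rewrite (introT idP (proj2 (gen_entries_sub _ _) _)); last first.
  by apply/(hur_in _ _ hj)/gen_entries_sub.
by apply/gen_entries_sub/(hur_in _ _ hj)/gen_entries_sub.
Qed.

Lemma prod_entries t : \prod_(i < m) tnth t i = \prod_(0 <= k < m) ent t k.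
Proof. by rewrite big_mkord; apply: eq_bigr => i _; rewrite (tnth_nth 1). Qed.

(** Only the two adjacent factors change, and [(x y x^-1) x = x y]. *)
Lemma prod_hur j t : (1 < j <= m)%N ->
  \prod_(i < m) tnth (hur j t) i = \prod_(i < m) tnth t i.
Proof.
move=> hj; rewrite !prod_entries.
rewrite !(@big_cat_nat _ _ _ j.-2 0 m) /=; try lia.
rewrite !(@big_cat_nat _ _ _ j j.-2 m) /=; try lia.
congr (_ * (_ * _)).
- apply: eq_big_nat => k hk; rewrite ent_hur //.
  have -> : (k == j.-2) = false by lia.
  by have -> : (k == j.-1) = false by lia.
- have e : index_iota j.-2 j = [:: j.-2; j.-1].
    by case: j hj => [|[|j]] //= _; rewrite /index_iota (_ : j.+2 - j = 2)%N //; lia.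
  have nj : (j.-1 == j.-2) = false by lia.
  rewrite e !big_cons !big_nil !ent_hur // nj !eqxx !mulg1.
  by rewrite /conjg invgK !mulgA mulgKV.
apply: eq_big_nat => k hk; rewrite ent_hur //.
have -> : (k == j.-2) = false by lia.
by have -> : (k == j.-1) = false by lia.
Qed.

Lemma Sigma_hur (G : {group gT}) x j X : (1 < j <= m)%N -> x \in G ->
  let Cs := [tuple x ^: G | _ < m] in
  X \in Sigma_i G Cs -> Pset (beta gT m j) X \in Sigma_i G Cs.
Proof.
move=> hj xG Cs /imsetP[t]; rewrite inE => /andP[/andP[/forallP tC tG] t1] ->.
rewrite Pset_beta_tclass; apply: imset_f; rewrite inE gen_hur // tG prod_hur // t1.
rewrite !andbT; apply/forallP => i.
have tC' k : (k < m)%N -> ent t k \in x ^: G.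
  by move=> km; have := tC (Ordinal km); rewrite tnth_mktuple (tnth_nth 1).
rewrite (tnth_nth 1) tnth_mktuple -/(ent _ _) ent_hur //; case: ifP => _.
  have /imsetP[g gG ->] := tC' j.-1 (ltac:(lia)).
  have /imsetP[h hG ->] := tC' j.-2 (ltac:(lia)).
  by rewrite -conjgM memJ_class // groupM // groupV groupJ.
by case: ifP => _; apply: tC' => //; lia.
Qed.

End Systems.

(** Shows that the outer factors of [beta2] are mutually inverse, so [beta2 i j] is a conjugate of
    the square of [beta j]. *)
Lemma prodgV_rev (hT : finGroupType) (F : nat -> hT) m n :
  \prod_(m.+1 <= k < n) (F k)^-1 = (\prod_(m.+1 <= k < n) F (m + n - k)%N)^-1.
Proof.
have [mn|nm] := ltnP m n; last by rewrite !big_geq ?invg1 //; lia.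
elim: n mn => // n IH; rewrite ltnS leq_eqVlt => /orP[/eqP<-|mn].
  by rewrite !big_geq ?invg1.
rewrite big_nat_recr //= IH // [in RHS]big_ltn // invMg.
have -> : (m + n.+1 - m.+1 = n)%N by lia.
congr (_^-1 * _); rewrite big_add1 /=; apply: eq_big_nat => k hk.
by congr F; lia.
Qed.

Lemma braid_root_neq0 j : (2 <= j <= 6)%N -> braid_root j != 0%R.
Proof.
rewrite -quad_of_row0 row_of_quadK.
by case: j => [|[|[|[|[|[|[|j]]]]]]].
Qed.

Section Orbit.
Variables (gT : finGroupType) (f : rV -> {set 6.-tuple gT}).
Local Notation r j := (Pset (beta gT 6 j)).
Hypothesis f_tau : forall j (v : rV), (2 <= j <= 6)%N -> v != 0%R ->
  r j (f v) = f (v *m GLmx (tau j))%R.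

(** The square of [tau j] is a transvection of coefficient 2 = -1, and conjugation moves its root to
    [w]. *)
Lemma represents_beta2 i j : (1 <= i < j)%N -> (j <= 6)%N ->
  exists2 w, w != 0%R & represents f (Pset (beta2 gT 6 i j)) (transvection (-1)%R w).
Proof.
move=> ij j6; set c := \prod_(i.+1 <= k < j) beta gT 6 (i + j - k).
have [h hT hc] : exists2 h, h \in T & represents f (Pset c) h.
  rewrite /c big_nat_cond; elim/big_ind: _.
  - exists (1 : GL43); first exact: group1.
    have -> : Pset (1 : {perm 6.-tuple gT}) = 1 by rewrite -(mulgV 1) PsetM PsetV mulgV.
    exact: represents1.
  - move=> p q [g gT' hg] [k kT hk]; exists (g * k); first by rewrite groupM.
    by rewrite PsetM; apply: representsM.
  move=> k; rewrite andbT => hk; exists (tau (i + j - k)); first by apply: tau_in; lia.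
  by apply: (represents_tau f_tau) => //; lia.
exists (braid_root j *m GLmx h)%R.
  by rewrite mul_GLmx_eq0 braid_root_neq0 //; lia.
have hj : represents f (r j) (tau j) by apply: (represents_tau f_tau) => //; lia.
rewrite /beta2 prodgV_rev -/c !PsetM PsetV -transvectionJ; last first.
  by rewrite -braid_group_Sp.
have -> : transvection (-1)%R (braid_root j) = tau j * tau j.
  by rewrite transvectionM; congr transvection; apply/eqP.
rewrite /conjg -!mulgA; apply: representsM; first exact: representsV.
by apply: representsM => //; apply: representsM.
Qed.

End Orbit.

(** The value is 1 - 40 + (5 * 40 - 5 * 22) / 2 = 6. *)
Lemma genus_40 (z : nat -> nat) :
  (forall j, (2 <= j <= 6)%N -> z j = 22) -> genus 6 40 z = 6%:R%R.
Proof.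
move=> hz; rewrite /genus /sum_z (eq_big_nat _ _ (F2 := fun _ => 22)) //.
by rewrite sum_nat_const_nat; apply/eqP.
Qed.

(** With equal generators [G] would be cyclic, hence equal to its trivial centre. *)
Lemma neq_generators (gT : finGroupType) (G : {group gT}) (s1 s2 : gT) :
  G :!=: 1 -> 'Z(G) = 1 -> G :=: <<[set s1; s2]>> -> s1 != s2.
Proof.
move=> G1 Z1 defG; apply: contraNneq G1 => e.
have abG : abelian G by rewrite defG -e setUid cycle_abelian.
by rewrite -Z1 eq_sym; apply/eqP/center_idP.
Qed.

Theorem theorem9 (gT : finGroupType) (G : {group gT}) (s1 s2 : gT) :
  G :!=: 1 ->
  'Z(G) = 1 ->
  G :=: <<[set s1; s2]>> ->
  s1 * s2 * s1 = s2 * s1 * s2 ->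
  #[s1 * s2 * s1] = 2%N ->
  let C := s1 ^: G in
  let X0 := tclass G [tuple s1; s2; s1; s1; s2; s1] in
  let ZB := orbit 'P <<B_gens gT 6>> X0 in
  let ZH := orbit 'P <<H_gens gT 6>> X0 in
  (ZB = ZH) /\
      (ZB \subset Sigma_i G [tuple C; C; C; C; C; C]) /\
      (#|ZB| = 40%N) /\
      (forall i j : nat, (1 <= i < j)%N -> (j <= 6)%N ->
        cycle_type_1_3 ZB (restr_perm ZB (Pset (beta2 gT 6 i j))) 13 9) /\
      (restr_perm ZB @* <<B_gens gT 6>> \isog PSp43) /\
      (forall j : nat, (2 <= j <= 6)%N ->
        cycle_type_1_3 ZH (restr_perm ZH (Pset (beta gT 6 j))) 13 9) /\
      (restr_perm ZH @* <<H_gens gT 6>> \isog PSp43) /\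
      (genus 6 #|ZB| (fun j => ncycles ZB (restr_perm ZB (Pset (beta2 gT 6 1 j))))
        = 6%:R%R).
Proof.
move=> G1 Z1 defG braid ord2 C X0 ZB ZH.
have neq12 := neq_generators G1 Z1 defG.
have inv : (s1 * s2 * s1) ^+ 2 = 1 by rewrite -ord2 expg_order.
pose f := system_class G s1 s2; pose r j := Pset (beta gT 6 j).
have fN : forall v, f (- v)%R = f v by exact: system_classN.
have f_tau j (v : rV) : (2 <= j <= 6)%N -> v != 0%R ->
    r j (f v) = f (v *m GLmx (tau j))%R by exact: system_class_tau.
have X0f : X0 = f base_row by exact: base_class.
have v0_e0 : sform base_row (std_row 0) != 0%R by rewrite sformE !row_of_quadK.
have f_v0 : r 2 (f base_row) != f base_row by rewrite -X0f; exact: beta2_moves_base.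
have restrE := @restr_phi _ f r base_row fN f_tau v0_e0 f_v0.
(* As 4 = 1 in F_3, [tau j] is recovered from the action of pure braids, which yields its square. *)
have tau4 j : tau j * tau j * (tau j * tau j) = tau j.
  by rewrite !transvectionM; congr transvection; apply/eqP.
have [imB orbB] : restr_perm (f @: [set v : rV | v != 0%R]) @* <<B_gens gT 6>>
     = actperm (line_action fN f_tau v0_e0 f_v0) @* Sp
   /\ orbit 'P <<B_gens gT 6>> (f base_row) = f @: [set v : rV | v != 0%R].
  apply: restr_generated => [p|j hj].
    case/imsetP=> -[i j]; rewrite inE /= => hij ->.
    have j6 : (j <= 6)%N by rewrite -ltnS.
    have [w _ hw] := represents_beta2 f_tau hij j6.
    by exists (transvection (-1)%R w) => //; exact: transvection_in_braid_group.
  (* For adjacent indices both outer products are empty and [beta2] is the square of [beta j]. *)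
  pose p := Pset (beta2 gT 6 j.-1 j).
  have hp : represents f p (tau j * tau j).
    rewrite /p /beta2 prednK ?big_geq //; last lia.
    rewrite mulg1 mul1g PsetM.
    by apply: representsM; apply: (represents_tau f_tau).
  have j7 : (j < 7)%N by lia.
  have j7' : (j.-1 < 7)%N by lia.
  exists (p * p).
    have pB : p \in <<B_gens gT 6>>.
      apply/mem_gen/imsetP; exists (Ordinal j7', Ordinal j7) => //.
      by rewrite inE /=; lia.
    by rewrite groupM.
  have [_ ->] := restrE _ _ (representsM hp hp).
  by rewrite tau4.
have [imH orbH] : restr_perm (f @: [set v : rV | v != 0%R]) @* <<H_gens gT 6>>
     = actperm (line_action fN f_tau v0_e0 f_v0) @* Sp
   /\ orbit 'P <<H_gens gT 6>> (f base_row) = f @: [set v : rV | v != 0%R].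
  apply: restr_generated => [p|j hj].
    case/imsetP=> j; rewrite inE => j2 ->.
    have hj : (2 <= j <= 6)%N by rewrite j2 -ltnS ltn_ord.
    exists (tau j); first exact: tau_in.
    exact: (represents_tau f_tau).
  exists (r j).
    have j7 : (j < 7)%N by lia.
    apply/mem_gen/imsetP; exists (Ordinal j7) => //.
    by rewrite inE; case/andP: hj.
  by have [_ ->] := restrE _ _ (represents_tau f_tau hj).
have eB : ZB = f @: [set v : rV | v != 0%R] by rewrite /ZB X0f.
have eH : ZH = f @: [set v : rV | v != 0%R] by rewrite /ZH X0f.
have cB : #|ZB| = 40 by rewrite eB; exact: (card_lines fN f_tau v0_e0 f_v0).
have cycB i j : (1 <= i < j)%N -> (j <= 6)%N ->
    cycle_type_1_3 ZB (restr_perm ZB (Pset (beta2 gT 6 i j))) 13 9 /\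
    ncycles ZB (restr_perm ZB (Pset (beta2 gT 6 i j))) = 22.
  move=> hij j6; have [w w0 hw] := represents_beta2 f_tau hij j6.
  rewrite eB; have [_ ->] := restrE _ _ hw.
  exact: phi_transvection_cycles.
split; first by rewrite eB eH.
split.
  (* Invariance is checked on the generators [beta j], whose effect on entries is explicit. *)
  have -> : ZB = ZH by rewrite eB eH.
  have eC : [tuple C; C; C; C; C; C] = [tuple C | _ < 6].
    apply: eq_from_tnth => i; rewrite tnth_mktuple (tnth_nth C) /=.
    by case: i => [[|[|[|[|[|[|//]]]]]] ?].
  have s1C : s1 \in C by apply: class_refl.
  have mem_s1 := mem_s1 defG; have mem_s2 := mem_s2 defG.
  have s2C : s2 \in C.
    have <- : s1 ^ (s1 * s2)^-1 = s2.
      by rewrite /conjg invgK mulgA braid -(mulgA s2) mulgK.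
    by rewrite memJ_class // groupV groupM.
  rewrite acts_sub_orbit ?eC.
    rewrite -eC /X0; apply: imset_f; rewrite inE; apply/andP; split; last first.
      (* The product of the six entries is the square of the involution [s1 * s2 * s1]. *)
      rewrite !big_ord_recl big_ord0 /= !(tnth_nth 1) /= mulg1.
      by apply/eqP; rewrite -inv expgS expg1 !mulgA.
    apply/andP; split.
      by apply/forallP=> -[[|[|[|[|[|[|//]]]]]] ?]; rewrite !(tnth_nth 1).
    rewrite eqEsubset; apply/andP; split.
      apply/gen_entries_sub => k; rewrite /ent.
      by case: k => [|[|[|[|[|[|k]]]]]] //=; rewrite nth_nil.
    rewrite {1}defG; apply: genS; apply/subsetP => x.
    rewrite !inE => /orP[]/eqP->; apply/imsetP.
      by exists (@Ordinal 6 0 isT); rewrite // (tnth_nth 1).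
    by exists (@Ordinal 6 1 isT); rewrite // (tnth_nth 1).
  rewrite gen_subG; apply/subsetP => _ /imsetP[j + ->]; rewrite inE => j2.
  rewrite !inE; apply/subsetP => X hX; rewrite inE.
  apply: Sigma_hur => //; first by rewrite j2 -ltnS ltn_ord.
split=> //; split; first by move=> i j hij j6; case: (cycB i j hij j6).
split; first by rewrite eB imB; exact: phi_Sp_isog.
split.
  move=> j hj; rewrite eH.
  have [_ ->] := restrE _ _ (represents_tau f_tau hj).
  have wj : braid_root j != 0%R by exact: braid_root_neq0.
  by case: (@phi_transvection_cycles _ f r base_row fN f_tau v0_e0 f_v0 _ _ (oner_neq0 _) wj).
split; first by rewrite eH imH; exact: phi_Sp_isog.
rewrite cB; apply: genus_40 => j hj.
by case: (cycB 1%N j) => //; lia.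
Qed.
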